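(* Given any $\epsilon > 0$, any algorithm achieving a $(\frac{4}{3}-\epsilon)$-approximation for the Monotone Submodular $k$-Multiway Partitioning problem (Mon-Sub-$k$-MP) when $k$ is part of the input, requires exponentially many queries in the value oracle model.
   Context: For a finite set $V$, a function $f:2^V\to\mathbb{R}$ is submodular if $f(A\cup\{v\})-f(A)\ge f(B\cup\{v\})-f(B)$ for all $A\subseteq B\subseteq V$ and $v\notin B$; it is monotone if $f(A)\le f(B)$ whenever $A\subseteq B\subseteq V$. The symbol $\uplus$ denotes the union of disjoint sets and $[k]=\{1,\dots,k\}$. Mon-Sub-$k$-MP: given a non-negative monotone submodular function $f:2^V\to\mathbb{R}_+$ over a ground set $V$, partition $V$ into $k$ non-empty sets so as to attain $$\min \sum_{i=1}^k f(S_i)\quad\text{s.t. } S_1\uplus S_2\uplus\cdots\uplus S_k=V,\ S_i\neq\emptyset \text{ for all } i\in[k].$$ Value oracle model: $f$ is accessed through an oracle that returns $f(S)$ for a given set $S\subseteq V$. Hardness results in this model are information-theoretic: they are limits on the approximability of a problem when only polynomially many queries to the value oracle are allowed. An algorithm achieves an $\alpha$-approximation if it outputs a feasible $(S_1,\dots,S_k)$ with $\sum_i f(S_i)$ at most $\alpha$ times the optimal value. *)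

(* Defs.v *)
From HB Require Import structures.
From mathcomp Require Import all_boot all_order all_algebra.
From mathcomp Require Import all_classical all_reals all_analysis.

Set Implicit Arguments.
Unset Strict Implicit.
Unset Printing Implicit Defensive.

Import Order.TTheory GRing.Theory Num.Theory.
Local Open Scope ring_scope.

Section Problem.
Context {R : realType} {V : finType}.
Implicit Type f : {set V} -> R.

Definition submodular f : Prop :=
  forall (A B : {set V}) (v : V), A \subset B -> v \notin B ->
    f (B :|: [set v]) - f B <= f (A :|: [set v]) - f A.

Definition monotone_setfun f : Prop :=
  forall A B : {set V}, A \subset B -> f A <= f B.

Definition mon_sub f : Prop :=
  [/\ forall A, 0 <= f A, monotone_setfun f & submodular f].

Definition feasible (k : nat) (S : {ffun 'I_k -> {set V}}) : Prop :=
  [/\ forall i, S i != finset.set0,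
      forall i j, i != j -> [disjoint S i & S j]
    & \bigcup_(i < k) S i = [set: V]]%SET.

Definition cost (k : nat) f (S : {ffun 'I_k -> {set V}}) : R :=
  \sum_(i < k) f (S i).

(* The set of costs is finite, and it is nonempty when 1 <= k <= #|V|; in that
   case the infimum is a minimum. *)
Definition opt (k : nat) f : R :=
  inf [set cost f S | S in [set S : {ffun 'I_k -> {set V}} | feasible S]]%classic.

Definition approx_solution (k : nat) (alpha : R) f
    (S : {ffun 'I_k -> {set V}}) : Prop :=
  feasible S /\ cost f S <= alpha * opt k f.

(* A deterministic, adaptive, computationally unbounded algorithm in the value
   oracle model: the next query, or the output, is an arbitrary function of the
   oracle answers received so far. *)
Inductive oracle_alg (k : nat) : Type :=
  | Output of {ffun 'I_k -> {set V}}
  | Query of {set V} & (R -> oracle_alg k).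

(* Number of oracle calls and output of an execution against the oracle f. *)
Fixpoint run (k : nat) f (a : oracle_alg k) : nat * {ffun 'I_k -> {set V}} :=
  match a with
  | Output T => (0%N, T)
  | Query Q next => let r := run f (next (f Q)) in (r.1.+1, r.2)
  end.

End Problem.

Arguments oracle_alg R V k : clear implicits.

Section Randomized.
Context {R : realType} {d : measure_display} {Omega : measurableType d}.
Local Open Scope classical_set_scope.

(* An algorithm receives n and k as input, the ground set being 'I_n, together
   with a random seed in Omega: it is a random deterministic algorithm.
   Deterministic algorithms are those that ignore the seed. *)
Definition algorithm : Type := forall n k : nat, Omega -> oracle_alg R 'I_n k.

Definition measurable_algorithm (A : algorithm) : Prop :=
  forall (n k : nat) (f : {set 'I_n} -> R), mon_sub f ->
  forall r, measurable [set w | run f (A n k w) = r].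

(* On every instance, the output is an alpha-approximation with probability at
   least p.  A guarantee that the expected cost is at most alpha * opt implies
   this, by Markov's inequality, for any larger alpha and some constant p. *)
Definition achieves_approx (P : probability Omega R) (p alpha : R)
    (A : algorithm) : Prop :=
  forall (n k : nat) (f : {set 'I_n} -> R), (1 <= k <= n)%N -> mon_sub f ->
    (p%:E <= P [set w | approx_solution alpha f (run f (A n k w)).2])%E.

Definition expected_queries (P : probability Omega R) (A : algorithm)
    (n k : nat) (f : {set 'I_n} -> R) : \bar R :=
  (\int[P]_w ((run f (A n k w)).1%:R)%:E)%E.

End Randomized.

Arguments algorithm R {d} Omega.

(* Main.v *)
(* Split the ground set into m pairs (plus at most one extra element), hide a
   uniformly random transversal H of the pairs, and let k = |V \ H| + 1.  The
   function min(m, |S \ H| + min((1 + s) m / 2, |S & H|)) has a k-partition of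
   cost about 3m/2 (H and singletons), whereas every k-partition costs at least
   |V|, about 2m, under min(m, |S|).  The two functions differ at S only if
   |S & H| - |S \ H| > s m, which for a fixed S has probability at most
   exp(- s^2 m / 8).  So an algorithm making few queries sees only min(m, |S|),
   and its output, being fixed independently of H, would have to contain such
   an S to beat the ratio 4/3.  The random seed is handled by averaging over
   H. *)
Require Import Defs.
From HB Require Import structures.
From mathcomp Require Import all_boot all_order all_algebra.
From mathcomp Require Import all_classical all_reals all_analysis.
From mathcomp Require Import measurable_realfun lra ring zify.

Set Implicit Arguments.
Unset Strict Implicit.
Unset Printing Implicit Defensive.

Import Order.TTheory GRing.Theory Num.Theory.
Local Open Scope ring_scope.

(** * Monotone submodular functions and costs of partitions *)

Section MonSub.
Context {R : realType} {V : finType}.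
Implicit Types f g : {set V} -> R.

Lemma mon_sub_cardI (X : {set V}) : mon_sub (fun S => #|S :&: X|%:R : R).
Proof.
split=> [A|A B sAB|A B v sAB vB]; first exact: ler0n.
- by rewrite ler_nat subset_leq_card// finset.setSI.
- have step (C : {set V}) : v \notin C ->
      #|(C :|: [set v]) :&: X|%:R - #|C :&: X|%:R = (v \in X)%:R :> R.
    move=> vC; rewrite finset.setIUl cardsU.
    have -> : C :&: X :&: ([set v] :&: X) = finset.set0.
      apply/setP => x; rewrite !inE.
      by case: eqP => [->|]; rewrite ?(negbTE vC) ?andbF.
    rewrite cards0 subn0 natrD addrAC subrr add0r; congr _%:R.
    case: (boolP (v \in X)) => vX.
      by rewrite (finset.setIidPl _) ?cards1// finset.sub1set.
    by apply/eqP; rewrite cards_eq0 setI_eq0 disjoints1.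
  by rewrite !step// (contraNN _ vB)//; exact: (fintype.subsetP sAB).
Qed.

Lemma mon_subD f g : mon_sub f -> mon_sub g -> mon_sub (fun S => f S + g S).
Proof.
move=> [f0 fm fs] [g0 gm gs]; split=> [A|A B sAB|A B v sAB vB].
- exact: addr_ge0.
- by apply: lerD; [exact: fm | exact: gm].
- by have := fs _ _ _ sAB vB; have := gs _ _ _ sAB vB; lra.
Qed.

Lemma mon_sub_min (c : R) f :
  0 <= c -> mon_sub f -> mon_sub (fun S => Num.min c (f S)).
Proof.
move=> c0 [f0 fm fs]; split=> [A|A B sAB|A B v sAB vB].
- by rewrite le_min c0 f0.
- by rewrite le_min !ge_min lexx (fm _ _ sAB) orbT.
(* Once it is fixed which of the four values exceed [c], submodularity and these monotonicity facts
   leave only linear inequalities. *)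
- have := fs _ _ _ sAB vB; have := fm _ _ sAB.
  have := fm _ _ (finset.subsetUl A [set v]).
  have := fm _ _ (finset.subsetUl B [set v]).
  have := fm _ _ (finset.setSU [set v] sAB).
  rewrite /Num.min /Order.min /=.
  by do 4 case: ifPn => //; rewrite -?leNgt; lra.
Qed.

Lemma cost_ge0 k f (S : {ffun 'I_k -> {set V}}) : mon_sub f -> 0 <= cost f S.
Proof. by case=> f0 _ _; apply: sumr_ge0. Qed.

Lemma opt_ge0 k f (S : {ffun 'I_k -> {set V}}) :
  mon_sub f -> feasible S -> 0 <= opt k f.
Proof.
move=> fms Sf; apply: lb_le_inf; first by exists (cost f S), S.
by move=> _ [T _ <-]; exact: cost_ge0.
Qed.

Lemma opt_le k f (S : {ffun 'I_k -> {set V}}) :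
  mon_sub f -> feasible S -> opt k f <= cost f S.
Proof.
move=> fms Sf; apply: ge_inf; last by exists S.
by exists 0 => _ [T _ <-]; exact: cost_ge0.
Qed.

(** With the hidden set as [X], this is the cheap partition bounding the planted optimum from above:
    [ord0] carries [X], the lifted indices enumerate its complement. *)
Lemma singletons_partition k (X : {set V}) :
  X != finset.set0 -> #|~: X| = k ->
  exists2 S : {ffun 'I_k.+1 -> {set V}}, feasible S &
    forall f, cost f S = f X + \sum_(x in ~: X) f [set x].
Proof.
move=> X0 <-.
pose S : {ffun 'I_#|~: X|.+1 -> {set V}} := [ffun i =>
  if unlift ord0 i is Some j then [set enum_val j] else X].
have S0 : S ord0 = X by rewrite ffunE unlift_none.
have SS j : S (lift ord0 j) = [set enum_val j] by rewrite ffunE liftK.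
exists S; last first.
  move=> f; rewrite /cost big_ord_recl S0; congr (_ + _).
  rewrite [RHS](big_enum_val (fun x => f [set x])) /=.
  by apply: eq_bigr => j _; rewrite SS.
have XS (j : 'I_#|~: X|) : enum_val j \notin X.
  by have := enum_valP j; rewrite inE.
split.
- move=> i; case: (unliftP ord0 i) => [j ->|->]; rewrite ?SS ?S0//.
  by rewrite -cards_eq0 cards1.
- move=> i i'; case: (unliftP ord0 i) => [j ->|->];
    case: (unliftP ord0 i') => [j' ->|->]; rewrite ?SS ?S0 ?eqxx//.
  + move=> jj'; rewrite disjoints1 inE; apply: contraNN jj' => /eqP.
    by move/enum_val_inj ->.
  + by move=> _; rewrite disjoints1.
  + by move=> _; rewrite disjoint_sym disjoints1.
- apply/setP => x; rewrite !inE; apply/bigcupP.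
  have [xX|xX] := boolP (x \in X); first by exists ord0; rewrite ?S0.
  have xXC : x \in ~: X by rewrite inE.
  exists (lift ord0 (enum_rank_in xXC x)) => //.
  by rewrite SS enum_rankK_in ?inE.
Qed.

(* A part of size above [m] already costs [m], and the other [k] parts cost at
   least [1] each; otherwise the parts cost their sizes. *)
Lemma cost_min_card_ge k m (S : {ffun 'I_k.+1 -> {set V}}) :
  (0 < m)%N -> (#|V| <= m + k)%N -> feasible S ->
  #|V|%:R <= cost (fun A => Num.min m%:R #|A|%:R : R) S.
Proof.
move=> m0 Vmk [Sn0 _ Scov]; rewrite /cost.
under eq_bigr do rewrite -natr_min.
rewrite -natr_sum ler_nat.
have [big|small] := boolP [exists i, m < #|S i|]%N.
  have /existsP[i mSi] := big.
  rewrite (bigD1 i)//= minEnat (minn_idPl (ltnW mSi)); apply: leq_trans Vmk _.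
  rewrite leq_add2l (@leq_trans (\sum_(j < k.+1 | j != i) 1))//.
    by rewrite sum1_card cardC1 card_ord.
  by apply: leq_sum => j _; rewrite leq_min m0 card_gt0 Sn0.
rewrite -cardsT -Scov.
apply: (@leq_trans (\sum_(i < k.+1) #|S i|)).
  elim/big_ind2 : _ => [|A a B b Aa Bb|//]; first by rewrite cards0.
  by rewrite (leq_trans (leq_card_setU a b).1)// leq_add.
apply: leq_sum => i _; rewrite leq_min leqnn andbT.
by move: small; rewrite negb_exists => /forallP/(_ i); rewrite -leqNgt.
Qed.

End MonSub.

(** * An exponential tail bound for signed sums *)

Section Chernoff.
Context {R : realType}.

(** Since [expR (- x) >= 1 - x], [expR x] is at most [(1 - x)^-1], and [(1 - x) * (1 + x + 2 * x ^+
    2) = 1 + x ^+ 2 * (1 - 2 * x) >= 1]. *)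
Lemma expR_le_quad (x : R) : x <= 1 / 2 -> expR x <= 1 + x + 2 * x ^+ 2.
Proof.
move=> x2; have x1 : 0 < 1 - x by lra.
have -> : expR x = (expR (- x))^-1 by rewrite expRN invrK.
apply: (@le_trans _ _ (1 - x)^-1).
  by rewrite lef_pV2 ?posrE ?expR_gt0//; exact: expR_ge1Dx.
have : 0 <= x ^+ 2 * (1 - 2 * x) by rewrite mulr_ge0 ?sqr_ge0//; lra.
by rewrite -div1r ler_pdivrMr//; lra.
Qed.

(** The linear terms of the two quadratic bounds cancel, leaving [2 + 4 * t ^+ 2]. *)
Lemma expR_sum_sign_le (t x : R) : 0 <= t -> t <= 1 / 2 -> `|x| <= 1 ->
  expR (t * x) + expR (- (t * x)) <= 2 * expR (2 * t ^+ 2).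
Proof.
move=> t0 t2 x1; have tx : `|t * x| <= 1 / 2.
  by rewrite normrM (ger0_norm t0) (le_trans _ t2)// ler_piMr.
have [tx1 tx2] : - (1 / 2) <= t * x /\ t * x <= 1 / 2.
  by move: tx; rewrite ler_norml => /andP.
have := @expR_le_quad (t * x) tx2.
have := @expR_le_quad (- (t * x)) ltac:(lra); rewrite sqrrN.
have := expR_ge1Dx (2 * t ^+ 2).
have : (t * x) ^+ 2 <= t ^+ 2.
  by rewrite exprMn ler_piMr ?sqr_ge0// -real_normK ?num_real// expr_le1.
lra.
Qed.

(** Chernoff's method, counting sign vectors instead of measuring them: the indicator of the event
    is bounded by an exponential, whose sum over all [b] factors over the coordinates. *)
Lemma rademacher_tail (m : nat) (s : R) (a : 'I_m -> R) :
  0 <= s -> s <= 1 -> (forall j, `|a j| <= 1) ->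
  #|[pred b : {ffun 'I_m -> bool} | s * m%:R < \sum_j (-1) ^+ b j * a j]|%:R
    <= expR (- (s ^+ 2 / 8 * m%:R)) * 2 ^+ m.
Proof.
move=> s0 s1 a1; set D := [pred b | _].
(* This [t] minimises the final exponent [2 * t ^+ 2 - t * s], with value [- s ^+ 2 / 8]; [s <= 1]
   keeps it below [1 / 2]. *)
pose t := s / 4; have t0 : 0 <= t by rewrite /t; lra.
apply: (@le_trans _ _ (\sum_(b : {ffun 'I_m -> bool})
    expR (- (t * (s * m%:R))) * \prod_j expR (t * ((-1) ^+ b j * a j)))).
  rewrite -sum1_card natr_sum big_mkcond/=; apply: ler_sum => b _.
  rewrite -expR_sum -expRD -mulr_sumr addrC -mulrBr.
  case: ifPn => [bD|_]; last exact: expR_ge0.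
  by rewrite -(expR0 R : _ = 1%:R) ler_expR mulr_ge0// subr_ge0 ltW.
rewrite -mulr_sumr -(bigA_distr_bigA
  (fun j (c : bool) => expR (t * ((-1) ^+ c * a j)))) /=.
apply: (@le_trans _ _ (expR (- (t * (s * m%:R))) *
                       \prod_(j < m) (2 * expR (2 * t ^+ 2)))).
  rewrite ler_wpM2l ?expR_ge0//; apply: ler_prod => j _.
  rewrite big_bool /= expr0 expr1 mul1r mulN1r mulrN.
  rewrite addr_ge0 ?expR_ge0//= addrC expR_sum_sign_le//.
  by rewrite /t; lra.
rewrite prodr_const card_ord exprMn -expRM_natl mulrCA mulrC -expRD.
by rewrite ler_wpM2r ?exprn_ge0// ler_expR /t -mulr_natr; lra.
Qed.

End Chernoff.

(** * Hidden transversals and planted functions *)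

Lemma split_lshift m n (i : 'I_m) : fintype.split (lshift n i) = inl i.
Proof. exact: (unsplitK (inl i)). Qed.

Lemma split_rshift m n (i : 'I_n) : fintype.split (rshift m i) = inr i.
Proof. exact: (unsplitK (inr i)). Qed.

Section HiddenSet.
Context {R : realType}.
Variables m o : nat.
Notation n := (m + m + o)%N.
Implicit Types (b : {ffun 'I_m -> bool}) (S : {set 'I_n}).

(* The ground set consists of [m] pairs and [o] extra elements; the bits [b]
   select the element of each pair that is hidden. *)
Definition hidden b : {set 'I_n} :=
  [set i : 'I_n | match fintype.split i with
           | inl i' =>
             match fintype.split i' with inl j => ~~ b j | inr j => b j end
           | inr _ => false
           end].

Lemma hidden_left b j : (lshift o (lshift m j) \in hidden b) = ~~ b j.
Proof. by rewrite inE !split_lshift. Qed.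

Lemma hidden_right b j : (lshift o (rshift m j) \in hidden b) = b j.
Proof. by rewrite inE split_lshift split_rshift. Qed.

Lemma hidden_extra b j : (rshift (m + m) j \in hidden b) = false.
Proof. by rewrite inE split_rshift. Qed.

Lemma card_hidden b : #|hidden b| = m.
Proof.
rewrite -sum1_card big_mkcond !big_split_ord/=.
rewrite [X in (_ + X)%N]big1 ?addn0; last by move=> j _; rewrite hidden_extra.
rewrite -big_split/= -[RHS]card_ord -sum1_card; apply: eq_bigr => j _.
by rewrite hidden_left hidden_right; case: (b j).
Qed.

Lemma card_hiddenC b : #|~: hidden b| = (m + o)%N.
Proof. by have := cardsC (hidden b); rewrite card_hidden card_ord; lia. Qed.

(** Signed so that [(-1) ^+ b j * imbalance S j] is what pair [j] contributes to [|S & H| - |S \ H|]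
    for [H = hidden b]. *)
Definition imbalance S (j : 'I_m) : R :=
  (lshift o (lshift m j) \in S)%:R - (lshift o (rshift m j) \in S)%:R.

Lemma imbalance_le1 S j : `|imbalance S j| <= 1.
Proof.
by rewrite /imbalance; do 2 case: (_ \in _);
  rewrite ?subrr ?subr0 ?sub0r ?normrN ?normr0 ?normr1.
Qed.

(** Equality holds on the pairs; the extra elements are never hidden and can only lower the left
    side. *)
Lemma hidden_excess b S :
  #|S :&: hidden b|%:R - #|S :&: ~: hidden b|%:R
    <= \sum_j (-1) ^+ b j * imbalance S j.
Proof.
rewrite -!sum1_card !natr_sum !(big_mkcond (fun i => i \in _)) -sumrB.
rewrite !big_split_ord/= -big_split/= -[leRHS]addr0 lerD//.
  apply: ler_sum => j _.
  rewrite !finset.in_setI !finset.in_setC hidden_left hidden_right.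
  by rewrite /imbalance; case: (b j); do 2 case: (_ \in S) => /=; lra.
apply: sumr_le0 => j _.
rewrite !finset.in_setI !finset.in_setC hidden_extra andbF.
by case: ifP => _; lra.
Qed.

Definition base S : R := Num.min m%:R #|S|%:R.

Definition planted (s : R) b S : R :=
  Num.min m%:R (#|S :&: ~: hidden b|%:R
                + Num.min ((1 + s) / 2 * m%:R) #|S :&: hidden b|%:R).

Lemma mon_sub_planted s b : 0 <= s -> mon_sub (planted s b).
Proof.
move=> s0; apply: mon_sub_min => //; apply: mon_subD.
  exact: mon_sub_cardI.
apply: mon_sub_min; last exact: mon_sub_cardI.
by rewrite mulr_ge0//; lra.
Qed.

(** A difference needs the inner cap to bind, so [|S & H| >= (1 + s) m / 2], and the outer cap not
    to absorb it, so [|S \ H| < (1 - s) m / 2]. *)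
Lemma planted_neq s b S : planted s b S != base S ->
  s * m%:R < \sum_j (-1) ^+ b j * imbalance S j.
Proof.
move=> neq; apply: lt_le_trans (hidden_excess b S); move: neq.
rewrite /planted /base -(cardsID (hidden b) S) finset.setDE natrD.
set x := #|S :&: hidden b|%:R; set y := #|_|%:R.
rewrite [x + y]addrC; case: (leP _ x) => [bx|]; last by rewrite eqxx.
case: (leP _ (y + x)) => h1; case: (leP _ (y + _)) => h2.
all: by rewrite ?eqxx// => _; lra.
Qed.

Lemma card_planted_neq s S : 0 <= s -> s <= 1 ->
  #|[pred b | planted s b S != base S]|%:R
    <= expR (- (s ^+ 2 / 8 * m%:R)) * 2 ^+ m.
Proof.
move=> s0 s1; apply: le_trans; last first.
  exact: (rademacher_tail s0 s1 (imbalance_le1 S)).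
by rewrite ler_nat; apply/subset_leq_card/fintype.subsetP => b;
  exact: planted_neq.
Qed.

Lemma opt_planted_le s b : (0 < m)%N -> 0 <= s ->
  0 <= opt (m + o).+1 (planted s b) <= (m + o)%:R + (1 + s) / 2 * m%:R.
Proof.
move=> m0 s0; have H0 : hidden b != finset.set0.
  by rewrite -card_gt0 card_hidden.
have [S Sf Sc] := @singletons_partition R _ _ _ H0 (card_hiddenC b).
have ms := mon_sub_planted b s0.
rewrite (opt_ge0 ms Sf) (le_trans (opt_le ms Sf))// Sc addrC lerD//.
  rewrite -(card_hiddenC b) -sum1_card natr_sum; apply: ler_sum => x xH.
  rewrite ge_min; apply/orP; right.
  apply: (@le_trans _ _ (#|[set x] :&: ~: hidden b|%:R +
                         #|[set x] :&: hidden b|%:R)).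
    by rewrite lerD2l ge_min lexx orbT.
  by rewrite -natrD ler_nat addnC -finset.setDE cardsID cards1.
by rewrite ge_min finset.setICr cards0 add0r ge_min lexx orbT.
Qed.

(** If all parts looked alike under both functions, the cost would be at least [2 m + o]. But
    [4 / 3 - eps] times the bound [3 m / 2 + o + s m / 2] on the optimum is smaller: the loss
    [o / 3 + 2 s m / 3] is outweighed by [3 eps m / 2]. *)
Lemma approx_planted_neq (s eps : R) b
    (S : {ffun 'I_(m + o).+1 -> {set 'I_n}}) :
  (o <= 1)%N -> 0 <= s -> s <= eps -> 4 < eps * m%:R ->
  approx_solution (4 / 3 - eps) (planted s b) S ->
  exists i, planted s b (S i) != base (S i).
Proof.
move=> o1 s0 se em [Sf Sc]; apply: contrapT => /forallNP eqS.
have m0 : (0 < m)%N by case: (m) em => //; rewrite mulr0; lra.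
have /andP[op0 op1] := opt_planted_le b m0 s0.
have := @cost_min_card_ge R _ _ m S m0.
rewrite card_ord addnA leqnn => /(_ isT Sf).
have -> : cost (fun A => Num.min m%:R #|A|%:R) S = cost (planted s b) S.
  apply: eq_bigr => i _; apply/eqP; rewrite eq_sym.
  by apply/negPn/negP; exact: eqS.
move=> /le_trans /(_ Sc); apply/negP; rewrite -ltNge.
have oR : o%:R <= 1 :> R by rewrite (ler_nat R o 1).
have mR : 0 <= m%:R :> R by [].
have oR0 : 0 <= o%:R :> R by [].
(* For a negative ratio the upper bound on the optimum is of no help, but its nonnegativity
   suffices. *)
have [a0|a0] := leP 0 (4 / 3 - eps); last first.
  by apply: (@le_lt_trans _ _ 0); [nra | rewrite ltr0n; lia].
apply: (le_lt_trans (ler_wpM2l a0 op1)); rewrite !natrD.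
have : s * m%:R <= eps * m%:R by rewrite ler_wpM2r.
have : 0 <= eps * s * m%:R by rewrite !mulr_ge0//; lra.
have : 0 <= eps * o%:R by rewrite mulr_ge0//; lra.
nra.
Qed.

End HiddenSet.

(** * Runs against two oracles that rarely differ *)

Section Oracle.
Context {R : realType} {V : finType} {k : nat}.
Implicit Types (f g : {set V} -> R) (a : oracle_alg R V k).

(* The first [M] queries made against [f], followed by the parts of the output
   when the execution ends within [M] queries. *)
Fixpoint trace M f a : seq {set V} :=
  match a, M with
  | Output T, _ => codom T
  | Query Q next, M'.+1 => Q :: trace M' f (next (f Q))
  | Query _ _, 0 => [::]
  end.

Lemma size_trace M f a : (size (trace M f a) <= M + k)%N.
Proof.
elim: a M => [T|Q next IH] [|M] //=; rewrite ?size_codom ?card_ord ?leq_addl//.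
by rewrite addSn ltnS.
Qed.

(** Equal answers lead both runs down the same branch of the decision tree, hence to the same
    output. *)
Lemma run_agree M f g a : ((run g a).1 <= M)%N ->
  (forall Q, Q \in trace M f a -> g Q = f Q) ->
  forall i, (run g a).2 i \in trace M f a.
Proof.
elim: a M => [T|Q next IH] [|M] //=.
- by move=> _ _ i; rewrite codom_f.
- by move=> _ _ i; rewrite codom_f.
- move=> le eqf i; have gQ : g Q = f Q by apply: eqf; rewrite mem_head.
  rewrite gQ in le *; rewrite inE IH ?orbT// => Q' Q'in.
  by apply: eqf; rewrite inE Q'in orbT.
Qed.

(** A union bound over the trace against [f], which does not depend on [b]: a short winning run
    forces [F b] and [f] to differ on it, since otherwise [run_agree] puts every output part there,
    against [winF]. *)
Lemma card_run_le (B : finType) (F : B -> {set V} -> R) f (q : R) M a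
    (win : B -> {ffun 'I_k -> {set V}} -> bool) :
  (forall S, #|[pred b | F b S != f S]|%:R <= q) ->
  (forall b T, win b T -> exists i, F b (T i) != f (T i)) ->
  #|[pred b | win b (run (F b) a).2 && ((run (F b) a).1 <= M)%N]|%:R
    <= (M + k)%:R * q.
Proof.
move=> Fq winF; have q0 : 0 <= q by apply: le_trans (Fq finset.set0).
pose L := trace M f a.
apply: (@le_trans _ _ #|[pred b | has (fun S => F b S != f S) L]|%:R).
  rewrite ler_nat; apply/subset_leq_card/fintype.subsetP => b /andP[wb leM].
  have [i Fi] := winF _ _ wb; apply/negPn; rewrite inE -all_predC.
  apply/negP => /allP/= agree; move/negP: Fi; apply; apply/eqP.
  have agr S : S \in L -> F b S = f S by move/agree; rewrite negbK => /eqP.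
  exact/agr/run_agree.
apply: (@le_trans _ _ ((size L)%:R * q)); last first.
  by rewrite ler_wpM2r// ler_nat size_trace.
elim: L => [|S L IH]; first by rewrite mul0r eq_card0.
rewrite -[(size _)%:R]natr1 mulrDl mul1r addrC.
apply: le_trans (lerD (Fq S) IH); rewrite -natrD ler_nat.
by rewrite -cardUI (leq_trans _ (leq_addr _ _))// subset_leq_card//;
  apply/fintype.subsetP => b.
Qed.

End Oracle.

(** * Averaging over the random seed *)

Section Averaging.
Context {R : realType} {d : measure_display} {Omega : measurableType d}.
Variable P : probability Omega R.
Local Open Scope classical_set_scope.
Local Open Scope ereal_scope.

(** The sum is the expected number of events that occur, by exchanging sum and integral. *)
Lemma sum_probability_le (B : finType) (E : B -> set Omega) (r : R) :
  (forall b, measurable (E b)) ->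
  (forall w, #|[pred b | `[< E b w >]]|%:R <= r)%R ->
  \sum_(b : B) P (E b) <= r%:E.
Proof.
move=> mE Er.
under eq_bigr do rewrite -[X in P X]setIT -integral_indic//=.
have mI b : measurable_fun [set: Omega] (EFin \o (\1_(E b) : Omega -> R)).
  by apply/measurable_EFinP; exact: measurable_indic.
have I0 b (w : Omega) : [set: Omega] w -> 0 <= (EFin \o (\1_(E b) : Omega -> R)) w.
  by rewrite lee_fin.
rewrite -(ge0_integral_sum _ measurableT mI I0).
apply: (@le_trans _ _ (\int[P]_w (cst r%:E) w)).
  apply: ge0_le_integral => //=.
  - by move=> w _; apply: sume_ge0 => b _; rewrite lee_fin.
  - exact: emeasurable_sum.
  - move=> w _; rewrite sumEFin lee_fin; apply: le_trans (Er w).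
    rewrite -sum1_card natr_sum [leRHS]big_mkcond/=.
    apply: ler_sum => b _.
    rewrite indicE inE; have [Ebw|Ebw] := pselect (E b w).
      by rewrite mem_set// asboolT.
    by rewrite memNset// asboolF.
by rewrite integral_cst// [X in _ * X](probability_setT P) mule1.
Qed.

Lemma measurable_preimage_count (T : countType) (X : Omega -> T) (D : set T) :
  (forall t, measurable [set w | X w = t]) -> measurable (X @^-1` D).
Proof.
move=> mX; have -> : X @^-1` D = \bigcup_(t in D) [set w | X w = t].
  apply/seteqP; split=> [w Dw|w [t Dt /= Xw]]; first by exists (X w).
  by rewrite /preimage/= Xw.
rewrite bigcup_mkcond; apply: countable_bigcupT_measurable => // t.
by case: ifP.
Qed.

Lemma markov_nat (X : Omega -> nat) (M : nat) :
  (forall j, measurable [set w | X w = j]) ->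
  M%:R%:E * P [set w | (M <= X w)%N] <= \int[P]_w ((X w)%:R)%:E.
Proof.
move=> mX; set E := [set w | (M <= X w)%N].
have mE : measurable E.
  exact: (@measurable_preimage_count _ X [set j | (M <= j)%N] mX).
rewrite -(setIT E) -integral_indic// -ge0_integralZl//; last first.
  by apply/measurable_EFinP; exact: measurable_indic.
have mXR : measurable_fun [set: Omega] (fun w => ((X w)%:R : R)%:E).
  apply/measurable_EFinP => _ Y _; rewrite setTI.
  exact: (@measurable_preimage_count _ X [set j | Y j%:R] mX).
apply: ge0_le_integral => //.
- by apply/measurable_EFinP/measurable_funM => //; exact: measurable_indic.
- move=> w _; rewrite -EFinM lee_fin indicE.
  have [Mw|Mw] := boolP (M <= X w)%N.
    by rewrite mem_set// mulr1 ler_nat.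
  by rewrite memNset ?mulr0//=; exact/negP.
Qed.

End Averaging.

(** With [E = expR (c * n%:R)], the first factor is at most [K * E] and the second at most [E ^- 2]
    because [n <= 4 * m]; the product [K / E] is below [K / (c * n%:R)], which tends to zero. *)
Lemma expR_count_lt (R : realType) (c p : R) : 0 < c -> 0 < p ->
  exists N, forall n m : nat, (N <= n)%N -> (n <= 4 * m)%N ->
  (2 / p * expR (c * n%:R) + 1 + n%:R) * expR (- (8 * c * m%:R)) < p / 2.
Proof.
move=> c0 p0; pose K := 2 / p + 1 + c^-1.
have K0 : 0 < K by rewrite !addr_gt0 ?divr_gt0 ?invr_gt0.
exists (Num.truncn (2 * K / (c * p))).+1 => n m Nn nm.
have nK : K / (c * n%:R) < p / 2.
  have : 2 * K / (c * p) < n%:R.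
    by rewrite (lt_le_trans (truncnS_gt _))// ler_nat.
  have n0 : (0 : R) < n%:R by rewrite ltr0n; lia.
  by rewrite !ltr_pdivrMr ?mulr_gt0//; lra.
apply: le_lt_trans nK.
have n0 : (0 : R) < n%:R by rewrite ltr0n; lia.
have cn0 : 0 < c * n%:R by rewrite mulr_gt0.
set E := expR (c * n%:R).
have E1 : 1 + c * n%:R <= E by exact: expR_ge1Dx.
have E0 : 0 < E by exact: expR_gt0.
have nE : n%:R <= c^-1 * E.
  by rewrite mulrC ler_pdivlMr// mulrC; lra.
apply: (@le_trans _ _ (K * E * expR (- (8 * c * m%:R)))).
  rewrite ler_wpM2r ?expR_ge0// /K !mulrDl mul1r; lra.
have -> : K / (c * n%:R) = K * E * (E * (c * n%:R))^-1.
  by field; rewrite !gt_eqF.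
rewrite ler_wpM2l ?mulr_ge0 ?(ltW K0) ?(ltW E0)//.
apply: (@le_trans _ _ (E * E)^-1).
  rewrite -expRD -expRN ler_expR.
  have : n%:R <= 4 * m%:R :> R by rewrite -natrM ler_nat.
  nra.
rewrite lef_pV2 ?posrE ?mulr_gt0// ler_wpM2l ?ltW//; lra.
Qed.

(** * Yao's principle: averaging over the hidden instance *)

Section Yao.
Context {R : realType} {d : measure_display} {Omega : measurableType d}.
Variables (P : probability Omega R) (V B : finType) (k : nat).
Variables (a : Omega -> oracle_alg R V k) (F : B -> {set V} -> R).
Variables (f : {set V} -> R) (q p : R) (M : nat).
Variable win : B -> {ffun 'I_k -> {set V}} -> Prop.
Local Open Scope classical_set_scope.

Hypothesis mrun : forall b r, measurable [set w | run (F b) (a w) = r].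
Hypothesis Fq : forall S, #|[pred b | F b S != f S]|%:R <= q * #|B|%:R.
Hypothesis winF : forall b T, win b T -> exists i, F b (T i) != f (T i).
Hypothesis winP : forall b, (p%:E <= P [set w | win b (run (F b) (a w)).2])%E.

Lemma measurable_run b (D : set (nat * {ffun 'I_k -> {set V}})) :
  measurable [set w | D (run (F b) (a w))].
Proof.
exact: (@measurable_preimage_count _ _ _ (fun w => run (F b) (a w)) D (mrun b)).
Qed.

(** If every instance had expectation below [C], then by Markov each would be won within [M] queries
    with probability at least [p / 2]. For each fixed seed, however, at most a fraction
    [(M + k) * q] of the instances is won so quickly. *)
Lemma many_queries (C : R) : (0 < #|B|)%N ->
  2 * C <= p * M.+1%:R -> (M + k)%:R * q < p / 2 ->
  exists b, (C%:E <= \int[P]_w ((run (F b) (a w)).1%:R)%:E)%E.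
Proof.
move=> B0 CM small; apply: contrapT => /forallNP few.
pose E b := [set w | win b (run (F b) (a w)).2 /\ ((run (F b) (a w)).1 <= M)%N].
have mE b : measurable (E b).
  exact: (measurable_run b [set r | win b r.2 /\ (r.1 <= M)%N]).
have PE b : ((p / 2)%:E <= P (E b))%E.
  pose H := [set w | (M < (run (F b) (a w)).1)%N].
  have mH : measurable H by exact: (measurable_run b [set r | (M < r.1)%N]).
  have M0 : (0 : R) < M.+1%:R by rewrite ltr0n.
  have PH : (P H <= (p / 2)%:E)%E.
    have := @markov_nat _ _ _ P (fun w => (run (F b) (a w)).1) M.+1
      (fun j => measurable_run b [set r | r.1 = j]).
    move=> /le_trans /(_ (ltW _)) => /(_ C%:E).
    have /negP := few b; rewrite -ltNge => fb /(_ fb).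
    rewrite -(fineK (fin_num_measure P H mH)) -EFinM !lee_fin => h.
    by rewrite -(ler_pM2l M0) (le_trans h)//; lra.
  have sub : [set w | win b (run (F b) (a w)).2] `<=` E b `|` H.
    move=> w /= ww; have [le|gt] := leqP (run (F b) (a w)).1 M.
      by left.
    by right.
  have mW : measurable [set w | win b (run (F b) (a w)).2].
    exact: (measurable_run b [set r | win b r.2]).
  have WEH : (P [set w | win b (run (F b) (a w)).2] <= P (E b `|` H))%E.
    by apply: le_measure; rewrite ?inE//; exact: measurableU.
  have PEH : (P (E b `|` H) <= P (E b) + P H)%E by exact: measureU2.
  have := le_trans (winP b) (le_trans WEH PEH).
  move: PH; rewrite -(fineK (fin_num_measure P H mH)).
  rewrite -(fineK (fin_num_measure P _ (mE b))) -EFinD !lee_fin; lra.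
have count w : #|[pred b | `[< E b w >]]|%:R <= (M + k)%:R * (q * #|B|%:R).
  have := card_run_le M (a w) (win := fun b T => `[< win b T >]) Fq.
  move=> /(_ (fun b T wT => winF (asboolW wT))); apply: le_trans.
  rewrite ler_nat; apply/subset_leq_card/fintype.subsetP => b.
  by move=> /asboolP[wb le]; apply/andP; split=> //; exact/asboolP.
have lo : (\sum_(b : B) (p / 2)%:E <= \sum_(b : B) P (E b))%E.
  by apply: lee_sum => b _.
have := le_trans lo (sum_probability_le P mE count).
rewrite sumEFin lee_fin sumr_const -[(p / 2) *+ _]mulr_natr mulrA.
by rewrite ler_pM2r ?ltr0n// leNgt small.
Qed.

End Yao.

(** * Choice of the parameters and conclusion *)

Theorem theorem2 (R : realType) (eps p : R) (heps : 0 < eps) (hp : 0 < p) :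
  exists (c : R) (N : nat), 0 < c /\
  forall (d : measure_display) (Omega : measurableType d)
         (P : probability Omega R) (A : algorithm R Omega),
    measurable_algorithm A ->
    achieves_approx P p (4 / 3 - eps) A ->
    forall n : nat, (N <= n)%N ->
    exists (k : nat) (f : {set 'I_n} -> R),
      [/\ (1 <= k <= n)%N,
          mon_sub f
        & ((expR (c * n%:R))%:E <= expected_queries P A k f)%E].
Proof.
(* The tail bound requires [s <= 1]. Its exponent [s ^+ 2 / 8] equals [8 * c], the form
   [expR_count_lt] expects. *)
pose s := Num.min eps 1; pose c := s ^+ 2 / 64.
have s0 : 0 < s by rewrite lt_min heps ltr01.
have s1 : s <= 1 by rewrite ge_min lexx orbT.
have seps : s <= eps by rewrite ge_min lexx.
have c0 : 0 < c by rewrite divr_gt0// exprn_gt0.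
have [N0 smallN] := expR_count_lt c0 hp.
(* The bound [4] gives at least one pair, and [16 / eps] gives [4 < eps * m%:R] through
   [n <= 4 * m]. *)
exists c, (maxn 4 (maxn N0 (Num.truncn (16 / eps)).+1)).
split=> // d Omega P A mA apxA n; rewrite !geq_max => /and3P[n4 nN0 neps].
have [m [ o [En o1 m0 n4m]]] :
    exists m o, [/\ n = m + m + o, o <= 1, 0 < m & n <= 4 * m]%N.
  by exists n./2, (odd n); have := odd_double_half n; case: (odd n); split; lia.
subst n; set n := (m + m + o)%N in n4 nN0 neps n4m *.
have em : 4 < eps * m%:R.
  have : 16 / eps < n%:R.
    by rewrite (lt_le_trans (truncnS_gt _))// ler_nat.
  have : n%:R <= 4 * m%:R :> R by rewrite -natrM ler_nat.
  rewrite ltr_pdivrMr//; nra.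
have k_n : (1 <= (m + o).+1 <= n)%N by rewrite /n; lia.
have ms b := @mon_sub_planted R m o s b (ltW s0).
pose q : R := expR (- (s ^+ 2 / 8 * m%:R)).
(* Markov's step uses that [M.+1] exceeds this real number, the union bound that [M] does not. *)
pose M := Num.truncn (2 / p * expR (c * n%:R)).
have x0 : 0 <= 2 / p * expR (c * n%:R).
  by rewrite mulr_ge0 ?expR_ge0// divr_ge0// ltW.
have [b expb] : exists b, ((expR (c * n%:R))%:E <=
    \int[P]_w ((run (planted s b) (A n (m + o).+1 w)).1%:R)%:E)%E.
  apply: (@many_queries _ _ _ P _ _ _ _ _ (@base R m o) q p M
    (fun b => approx_solution (4 / 3 - eps) (planted s b))).
  - by move=> b r; exact: mA.
  - move=> S; rewrite card_ffun card_bool card_ord natrX.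
    exact: card_planted_neq (ltW s0) s1.
  - by move=> b T; exact: approx_planted_neq o1 (ltW s0) seps em.
  - by move=> b; exact: apxA.
  - by rewrite card_ffun card_bool expn_gt0.
  - have : 2 / p * expR (c * n%:R) < M.+1%:R by exact: truncnS_gt.
    by rewrite mulrAC ltr_pdivrMr// => /ltW; rewrite [p * _]mulrC.
  - apply: le_lt_trans (smallN n m nN0 n4m).
    have -> : q = expR (- (8 * c * m%:R))
      by congr (expR (- _)); rewrite /c; lra.
    rewrite ler_wpM2r ?expR_ge0// natrD -addrA lerD ?truncn_le//.
    by rewrite nat1r ler_nat /n; lia.
by exists (m + o).+1, (planted s b).
Qed.
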